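(* Let $\mathbf{R}=\{R_i,t_i\}_{i\ge0}$ be a preperfectoid tower arising from a pair $(R,I_0)$. Fix $i\ge0$, and suppose that $R_i$ and $R_{i+1}$ are $I_0$-adically separated (i.e. $\bigcap_{n}I_0^nR_i=0$ and $\bigcap_nI_0^nR_{i+1}=0$). Then: (1) The transition map $t_i\colon R_i\to R_{i+1}$ is injective. (2) The ring $R_i$ is reduced.
   Context: All rings are commutative and unital. $p$ is a fixed prime. A pair $(A,I)$ is a ring $A$ with an ideal $I$. A tower of rings is an inductive system of rings $\mathbf{R}=\{R_i,t_i\colon R_i\to R_{i+1}\}_{i\ge0}$ indexed by $\mathbb{N}$. For a ring $A$, an ideal $I\subset A$ and an $A$-module $M$, an element $x\in M$ is $I$-torsion if for every $a\in I$ there is $n>0$ with $a^nx=0$; $M_{I\text{-tor}}$ is the submodule of $I$-torsion elements. Let $\varphi_{I,M}\colon M_{I\text{-tor}}\hookrightarrow M\twoheadrightarrow M/IM$ be the natural composite. $\varphi$ denotes the absolute Frobenius $x\mapsto x^p$ of an $\mathbb{F}_p$-algebra. Let $(R,I_0)$ be a pair and $\mathbf{R}=\{R_i,t_i\}_{i\ge0}$ a tower of rings. $\mathbf{R}$ is a preperfectoid tower arising from $(R,I_0)$ if: (a) $R_0=R$ and $p\in I_0$. (b) For every $i\ge0$, the ring homomorphism $\overline{t_i}\colon R_i/I_0R_i\to R_{i+1}/I_0R_{i+1}$ induced by $t_i$ is injective. (c) For every $i\ge0$, $\mathrm{Im}(\varphi_{R_{i+1}/I_0R_{i+1}})\subset\mathrm{Im}(\overline{t_i})$.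 (Given (a)–(c), there is a unique ring homomorphism $F_i\colon R_{i+1}/I_0R_{i+1}\to R_i/I_0R_i$ with $\overline{t_i}\circ F_i=\varphi$, called the $i$-th Frobenius projection.) (d) For every $i\ge0$, $F_i$ is surjective. (f) $I_0$ is principal, and $R_1$ contains a principal ideal $I_1$ such that $I_1^p=I_0R_1$ and, for every $i\ge0$, $\mathrm{Ker}(F_i)=I_1(R_{i+1}/I_0R_{i+1})$. (g) For every $i\ge0$, $I_0(R_i)_{I_0\text{-tor}}=(0)$, and there exists a bijection $(F_i)_{\mathrm{tor}}\colon(R_{i+1})_{I_0\text{-tor}}\to(R_i)_{I_0\text{-tor}}$ such that $F_i\circ\varphi_{I_0,R_{i+1}}=\varphi_{I_0,R_i}\circ(F_i)_{\mathrm{tor}}$. *)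

(* Defs.v *)
From HB Require Import structures.
From mathcomp Require Import all_boot all_algebra.
From mathcomp Require Import boolp classical_sets functions cardinality.

Set Implicit Arguments.
Unset Strict Implicit.
Unset Printing Implicit Defensive.

Import GRing.Theory.
Local Open Scope ring_scope.
Local Open Scope classical_set_scope.
Local Open Scope quotient_scope.

Identity Coercion set_to_fun : set >-> Funclass.

(* Rings are [comPzRingType]s, so that the zero ring is allowed; the ideals of
   [ring_quotient] are proper and decidable, hence the definition below. *)
Record ideal (A : comPzRingType) := Ideal {
  ideal_set :> set A;
  ideal0 : ideal_set 0;
  idealD : forall x y, ideal_set x -> ideal_set y -> ideal_set (x + y);
  idealM : forall a x, ideal_set x -> ideal_set (a * x) }.

Definition principal (A : comPzRingType) (I : ideal A) : Prop :=
  exists a : A, I = range ( *%R a) :> set A.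

Section IdealTheory.
Variables (A : comPzRingType) (I : ideal A).

Lemma idealN x : I x -> I (- x).
Proof. by move=> /(idealM (-1)); rewrite mulN1r. Qed.

Definition ideal_pred : {pred A} := fun x => `[< I x >].

Lemma ideal_predP : zmod_closed ideal_pred.
Proof.
split=> [|x y /asboolP Ix /asboolP Iy]; apply/asboolP; first exact: ideal0.
by apply: idealD => //; apply: idealN.
Qed.

HB.instance Definition _ := GRing.isZmodClosed.Build A ideal_pred ideal_predP.

(* The additive quotient comes from [ring_quotient]; its multiplication is
   redone here without the assumption 1 \notin I. *)
Definition ring_quot : Type := @Quotient.quot A ideal_pred.

HB.instance Definition _ := GRing.Zmodule.on ring_quot.

Definition ideal_pi : A -> ring_quot := \pi_(@Quotient.quot A ideal_pred).

Definition quot_repr (x : ring_quot) : A :=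
  repr (x : @Quotient.quot A ideal_pred).

Lemma quot_reprK x : ideal_pi (quot_repr x) = x.
Proof. exact: (@reprK _ (@Quotient.quot A ideal_pred)). Qed.

Lemma ideal_piP x y : ideal_pi x = ideal_pi y <-> I (x - y).
Proof.
split=> [/eqP|Ixy].
  by rewrite -Quotient.idealrBE => /asboolP.
by apply/eqP; rewrite -Quotient.idealrBE; apply/asboolP.
Qed.

Lemma ideal_pi_is_zmod_morphism : zmod_morphism ideal_pi.
Proof. by move=> x y; rewrite /ideal_pi raddfB. Qed.

HB.instance Definition _ :=
  GRing.isZmodMorphism.Build A ring_quot ideal_pi ideal_pi_is_zmod_morphism.

Definition quot_one : ring_quot := ideal_pi 1.
Definition quot_mul (x y : ring_quot) : ring_quot :=
  ideal_pi (quot_repr x * quot_repr y).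

Lemma quot_mulE x y : quot_mul (ideal_pi x) (ideal_pi y) = ideal_pi (x * y).
Proof.
have h z : I (quot_repr (ideal_pi z) - z).
  by apply/ideal_piP; rewrite quot_reprK.
apply/ideal_piP.
set x' := quot_repr (ideal_pi x); set y' := quot_repr (ideal_pi y).
have -> : x' * y' - x * y = x' * (y' - y) + y * (x' - x).
  by rewrite !mulrBr [y * x']mulrC [y * x]mulrC addrA addrNK.
by apply: idealD; apply: idealM; apply: h.
Qed.

Lemma quot_mulA : associative quot_mul.
Proof.
move=> x y z; rewrite -[x]quot_reprK -[y]quot_reprK -[z]quot_reprK.
by rewrite !quot_mulE mulrA.
Qed.

Lemma quot_mulC : commutative quot_mul.
Proof. by move=> x y; rewrite /quot_mul mulrC. Qed.

Lemma quot_mul1 : left_id quot_one quot_mul.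
Proof.
by move=> x; rewrite -[x]quot_reprK /quot_one quot_mulE mul1r.
Qed.

Lemma quot_mulDl : left_distributive quot_mul +%R.
Proof.
move=> x y z; rewrite -[x]quot_reprK -[y]quot_reprK -[z]quot_reprK.
by rewrite -raddfD !quot_mulE mulrDl raddfD.
Qed.

HB.instance Definition _ := GRing.Zmodule_isComPzRing.Build ring_quot
  quot_mulA quot_mulC quot_mul1 quot_mulDl.

Lemma ideal_pi_is_monoid_morphism : monoid_morphism ideal_pi.
Proof. by split=> // x y; rewrite -quot_mulE. Qed.

HB.instance Definition _ :=
  GRing.isMonoidMorphism.Build A ring_quot ideal_pi ideal_pi_is_monoid_morphism.

End IdealTheory.

Definition ideal_smul (A : comPzRingType) (M : lmodType A)
    (I : set A) (N : set M) : set M :=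
  [set x | exists2 s : seq (A * M),
    (forall u, u \in s -> I u.1 /\ N u.2) & x = \sum_(u <- s) u.1 *: u.2].

Definition torsion (A : comPzRingType) (I : ideal A) (M : lmodType A) : set M :=
  [set x | forall a, I a -> exists2 n, (0 < n)%N & a ^+ n *: x = 0].
Arguments torsion {A} I M.

(* [B] as an [A]-module through [f]. *)
Definition restrict (A B : comPzRingType) (f : {rmorphism A -> B}) : Type := B.

Section Restrict.
Variables (A B : comPzRingType) (f : {rmorphism A -> B}).

HB.instance Definition _ := GRing.Zmodule.on (restrict f).

Definition restrict_scale (a : A) (x : restrict f) : restrict f :=
  f a * (x : B).

Lemma restrict_scaleA a b x :
  restrict_scale a (restrict_scale b x) = restrict_scale (a * b) x.
Proof. by rewrite /restrict_scale rmorphM mulrA. Qed.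

Lemma restrict_scale1 : left_id 1 restrict_scale.
Proof. by move=> x; rewrite /restrict_scale rmorph1 mul1r. Qed.

Lemma restrict_scaleDr : right_distributive restrict_scale +%R.
Proof. by move=> a x y; apply: mulrDr. Qed.

Lemma restrict_scaleDl x : {morph restrict_scale^~ x : a b / a + b}.
Proof. by move=> a b; rewrite /restrict_scale rmorphD; apply: mulrDl. Qed.

HB.instance Definition _ := GRing.Zmodule_isLmodule.Build A (restrict f)
  restrict_scaleA restrict_scale1 restrict_scaleDr restrict_scaleDl.

Lemma restrict_scaleE (a : A) (x : restrict f) : a *: x = f a * (x : B) :> B.
Proof. by []. Qed.

End Restrict.

(* The ideal I B of B, for I an ideal of A and B an A-algebra through f. *)
Section Extension.
Variables (A B : comPzRingType) (f : {rmorphism A -> B}) (I : ideal A).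

Definition ext_set : set B := @ideal_smul A (restrict f) I setT.

Lemma ext_set0 : ext_set 0.
Proof. by exists [::]; rewrite ?big_nil. Qed.

Lemma ext_setD x y : ext_set x -> ext_set y -> ext_set (x + y).
Proof.
move=> [s Hs ->] [r Hr ->]; exists (s ++ r); last by rewrite big_cat.
by move=> u; rewrite mem_cat => /orP[/Hs|/Hr].
Qed.

Lemma ext_setM a x : ext_set x -> ext_set (a * x).
Proof.
move=> [s Hs ->]; exists [seq (u.1, a * (u.2 : B)) | u <- s].
  by move=> _ /mapP[u /Hs[Iu _] ->].
rewrite big_map mulr_sumr; apply: eq_bigr => u _ /=.
by rewrite !restrict_scaleE mulrCA.
Qed.

Definition ideal_ext : ideal B := Ideal ext_set0 ext_setD ext_setM.

Lemma mem_ideal_ext a : I a -> ideal_ext (f a).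
Proof.
move=> Ia; exists [:: (a, 1 : B)]; first by move=> u; rewrite inE => /eqP ->.
by rewrite big_seq1 restrict_scaleE mulr1.
Qed.

End Extension.

Section IdealPower.
Variable A : comPzRingType.

Definition ideal_full : ideal A :=
  @Ideal A setT I (fun _ _ _ _ => I) (fun _ _ _ => I).

Section Product.
Variables I J : ideal A.

Definition ideal_mul_set : set A := @ideal_smul A A^o I J.

Lemma ideal_mul0 : ideal_mul_set 0.
Proof. by exists [::]; rewrite ?big_nil. Qed.

Lemma ideal_mulD x y :
  ideal_mul_set x -> ideal_mul_set y -> ideal_mul_set (x + y).
Proof.
move=> [s Hs ->] [r Hr ->]; exists (s ++ r); last by rewrite big_cat.
by move=> u; rewrite mem_cat => /orP[/Hs|/Hr].
Qed.

Lemma ideal_mulM a x : ideal_mul_set x -> ideal_mul_set (a * x).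
Proof.
move=> [s Hs ->]; exists [seq (u.1, a * (u.2 : A)) | u <- s].
  by move=> _ /mapP[u /Hs[Iu Ju] ->]; split=> //; apply: idealM.
rewrite big_map mulr_sumr; apply: eq_bigr => u _ /=.
by rewrite -mulrCA.
Qed.

Definition ideal_mul : ideal A := Ideal ideal_mul0 ideal_mulD ideal_mulM.

End Product.

Definition ideal_pow (I : ideal A) (n : nat) : ideal A :=
  iter n (ideal_mul I) ideal_full.

End IdealPower.

Section QuotientMap.
Variables (A B : comPzRingType) (f : {rmorphism A -> B}).
Variables (I : ideal A) (J : ideal B) (IJ : forall x, I x -> J (f x)).

Definition quot_map of (forall x, I x -> J (f x)) :
    ring_quot I -> ring_quot J :=
  fun x => ideal_pi J (f (quot_repr x)).

Lemma quot_mapE x : quot_map IJ (ideal_pi I x) = ideal_pi J (f x).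
Proof.
apply/ideal_piP; rewrite -rmorphB; apply: IJ.
by apply/ideal_piP; rewrite quot_reprK.
Qed.

Lemma quot_map_is_zmod_morphism : zmod_morphism (quot_map IJ).
Proof.
move=> x y; rewrite -[x]quot_reprK -[y]quot_reprK -raddfB !quot_mapE.
by rewrite !raddfB.
Qed.

Lemma quot_map_is_monoid_morphism : monoid_morphism (quot_map IJ).
Proof.
split=> [|x y]; first by rewrite -(rmorph1 (ideal_pi I)) quot_mapE !rmorph1.
rewrite -[x]quot_reprK -[y]quot_reprK -rmorphM !quot_mapE.
by rewrite !rmorphM.
Qed.

HB.instance Definition _ := GRing.isZmodMorphism.Build
  (ring_quot I) (ring_quot J) (quot_map IJ) quot_map_is_zmod_morphism.
HB.instance Definition _ := GRing.isMonoidMorphism.Build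
  (ring_quot I) (ring_quot J) (quot_map IJ) quot_map_is_monoid_morphism.

End QuotientMap.

Lemma frobeniusD (A : comPzRingType) p (p_pr : prime p) (p0 : p%:R = 0 :> A)
  (x y : A) : (x + y) ^+ p = x ^+ p + y ^+ p.
Proof.
case: p p_pr p0 => // p p_pr p0.
rewrite exprDn big_ord_recr big_ord_recl /= binn subnn bin0 subn0.
rewrite expr0 mulr1 mul1r !mulr1n big1 ?addr0 // => j _.
have /dvdnP[k ->] : (p.+1 %| 'C(p.+1, bump 0 j))%N.
  by apply: prime_dvd_bin => //; have := ltn_ord j; rewrite /bump /= add1n.
by rewrite -mulr_natr natrM p0 !mulr0.
Qed.

Record tower := Tower {
  tower_ring :> nat -> comPzRingType;
  tower_map : forall i, {rmorphism tower_ring i -> tower_ring i.+1} }.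

Definition tower_shift (R : tower) : tower :=
  @Tower (fun i => R i.+1) (fun i => tower_map R i.+1).

Fixpoint from0 (R : tower) (i : nat) : {rmorphism R 0 -> R i} :=
  if i is j.+1 then (tower_map R j \o from0 R j : {rmorphism _ -> _})
  else (idfun : {rmorphism _ -> _}).

Definition from1 (R : tower) (i : nat) : {rmorphism R 1 -> R i.+1} :=
  from0 (tower_shift R) i.

Section Tower.
Variables (R : tower) (I0 : ideal (R 0)).

Definition level_ideal i : ideal (R i) := ideal_ext (from0 R i) I0.

Definition level_quot i : comPzRingType := ring_quot (level_ideal i).

Definition level_pi i : {rmorphism R i -> level_quot i} :=
  ideal_pi (level_ideal i).

Definition level_tor i : set (R i) := torsion I0 (restrict (from0 R i)).

Definition level_separated i : Prop :=
  \bigcap_n (ideal_ext (from0 R i) (ideal_pow I0 n) : set (R i)) = [set 0].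

Lemma tower_map_level i x :
  level_ideal i x -> level_ideal i.+1 (tower_map R i x).
Proof.
move=> [s Hs ->]; exists [seq (u.1, tower_map R i u.2) | u <- s].
  by move=> _ /mapP[u /Hs[Iu _] ->].
rewrite big_map raddf_sum; apply: eq_bigr => u _.
by rewrite /= !restrict_scaleE rmorphM.
Qed.

Definition tower_bar i : {rmorphism level_quot i -> level_quot i.+1} :=
  quot_map (@tower_map_level i).

Lemma tower_barE i x :
  tower_bar i (level_pi i x) = level_pi i.+1 (tower_map R i x).
Proof. exact: quot_mapE. Qed.

(* The maps F_i are a parameter, determined by [frobenius_projE]; their
   existence and uniqueness under the other conditions is proved below.
   The pair is (R 0, I0), so the condition R_0 = R holds by construction.  In
   [tower_tor_bij], the map phi_{I0, R_i} is [level_pi i] on [level_tor i]. *)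
Record preperfectoid_with (p : nat)
    (F : forall i, {rmorphism level_quot i.+1 -> level_quot i}) : Prop := {
  tower_p_mem : I0 p%:R;
  tower_bar_inj : forall i, injective (tower_bar i);
  tower_frob_sub : forall i,
    range (fun x : level_quot i.+1 => x ^+ p) `<=` range (tower_bar i);
  frobenius_projE : forall i x, tower_bar i (F i x) = x ^+ p;
  frobenius_proj_surj : forall i, range (F i) = setT;
  tower_principal : principal I0;
  tower_first_ideal : exists I1 : ideal (R 1),
    [/\ principal I1,
        ideal_pow I1 p = level_ideal 1 :> set (R 1)
      & forall i, [set x | F i x = 0] =
          ideal_ext (level_pi i.+1 \o from1 R i : {rmorphism _ -> _}) I1];
  tower_tor0 : forall i,
    @ideal_smul _ (restrict (from0 R i)) I0 (@level_tor i) = [set 0];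
  tower_tor_bij : forall i, exists Ftor : R i.+1 -> R i,
    set_bij (@level_tor i.+1) (@level_tor i) Ftor /\
    (forall x, level_tor x -> F i (level_pi i.+1 x) = level_pi i (Ftor x)) }.

Definition preperfectoid_tower (p : nat) : Prop :=
  exists F, preperfectoid_with p F.

Lemma frobenius_proj_unique i p
    (F G : level_quot i.+1 -> level_quot i) :
  injective (tower_bar i) ->
  (forall x, tower_bar i (F x) = x ^+ p) ->
  (forall x, tower_bar i (G x) = x ^+ p) -> F =1 G.
Proof. by move=> inj FE GE x; apply: inj; rewrite FE GE. Qed.

Lemma frobenius_proj_exists i p (p_pr : prime p) :
  I0 p%:R -> injective (tower_bar i) ->
  range (fun x : level_quot i.+1 => x ^+ p) `<=` range (tower_bar i) ->
  exists F : {rmorphism level_quot i.+1 -> level_quot i},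
    forall x, tower_bar i (F x) = x ^+ p.
Proof.
move=> Ip inj sub.
have p0 : p%:R = 0 :> level_quot i.+1.
  rewrite -(rmorph_nat (level_pi i.+1)) -(rmorph0 (level_pi i.+1)).
  by apply/ideal_piP; rewrite subr0 -(rmorph_nat (from0 R i.+1));
    apply: mem_ideal_ext.
have /choice[F FE] : forall x, exists y, tower_bar i y = x ^+ p.
  by move=> x; case: (sub (x ^+ p)) => [|y _ <-]; [exists x | exists y].
have FB : zmod_morphism F.
  move=> x y; apply/eqP; rewrite eq_sym subr_eq; apply/eqP/inj.
  by rewrite rmorphD !FE -(frobeniusD p_pr p0) subrK.
have FM : monoid_morphism F.
  split=> [|x y]; apply: inj; first by rewrite FE expr1n rmorph1.
  by rewrite rmorphM !FE exprMn.
pose mF := GRing.isZmodMorphism.Build _ _ F FB.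
pose mM := GRing.isMonoidMorphism.Build _ _ F FM.
pose rF : {rmorphism _ -> _} := HB.pack F mF mM.
by exists rF.
Qed.

End Tower.

Definition reduced (A : comPzRingType) : Prop :=
  forall (x : A) (n : nat), x ^+ n = 0 -> x = 0.

(* Main.v *)
(** Let [f] generate [I0], let [g] generate [I1], and let [T_i] be the torsion
ideal of [R_i], that is the annihilator of [f].  It meets [f R_i] trivially and
[F_i] maps [T_(i+1)] bijectively onto [T_i], so [T_i] contains no nonzero
nilpotent; hence [g] kills [T_(i+1)].

The map [R_i/(f, T_i) -> R_(i+1)/(f, T_(i+1))] is injective: if [t x] lies in
[T + (f)] and [F y = x], then [F (t y) = y^p = t x] modulo [f], so [t y] lies in
[T + (g)], [t (g^(p-1) y)] lies in [(f)], and so does [g^(p-1) y]; therefore [y]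
lies in [T + (g)] and [x = F y] in [T + (f)].  Iterating, the kernel of [t] is
contained in every [f^n R_i].

If [x^p] is torsion then [t x = s + g z] with [s] and [z^p] torsion.  Climbing
[p] steps up the tower gives [t x] in [T + (f)], hence [x = s' + f x'] where
[x'^p] is torsion again.  So [f x] lies in every [f^n R_i], and [x] is torsion;
if moreover [x^p = 0] then [x = 0]. *)

Require Import Defs.
From mathcomp Require Import all_boot all_algebra.
From mathcomp Require Import classical_sets.

Set Implicit Arguments.
Unset Strict Implicit.
Unset Printing Implicit Defensive.

Import GRing.Theory.
Local Open Scope ring_scope.
Local Open Scope classical_set_scope.

(** * Powers and principal ideals *)

Lemma exprD_mul0 (A : comPzRingType) (x y : A) n :
  (0 < n)%N -> x * y = 0 -> (x + y) ^+ n = x ^+ n + y ^+ n.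
Proof.
move=> + xy0; elim: n => // -[_ _|n IHn _]; first by rewrite !expr1.
have yx0 : y * x = 0 by rewrite mulrC.
rewrite exprS IHn // mulrDl !mulrDr (exprS y) (exprS x) !mulrA.
by rewrite xy0 yx0 !mul0r addr0 add0r !exprS !mulrA.
Qed.

(** Since [n <= p ^ n], a nilpotent has vanishing [p ^ n]-th power, and the factors [p] of this
    exponent are stripped one at a time. *)
Lemma reduced_prime_exponent (A : comPzRingType) p :
  (1 < p)%N -> (forall x : A, x ^+ p = 0 -> x = 0) -> reduced A.
Proof.
move=> p_gt1 redA x n xn0.
have : x ^+ (p ^ n)%N = 0.
  by rewrite -(subnK (ltnW (ltn_expl n p_gt1))) exprD xn0 mulr0.
by elim: (n) => [|k IHk]; rewrite ?expr1 // expnSr exprM => /redA.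
Qed.

Lemma mem_ideal_ext_principal (A B : comPzRingType) (h : {rmorphism A -> B})
    (I : ideal A) a x : I = range ( *%R a) :> set A ->
  ideal_ext h I x <-> exists y, x = h a * y.
Proof.
move=> Ia; split=> [[s Hs ->]|[y ->]].
  rewrite big_seq; elim/big_ind: _ => [|_ _ [y ->] [z ->]|u /Hs[]].
  - by exists 0; rewrite mulr0.
  - by exists (y + z); rewrite mulrDr.
  - by rewrite Ia => -[b _ <-] _; exists (h b * u.2);
      rewrite restrict_scaleE rmorphM mulrA.
rewrite mulrC; apply/idealM/mem_ideal_ext.
by rewrite Ia; exists 1; rewrite ?mulr1.
Qed.

Lemma mem_ideal_pow_principal (A : comPzRingType) (I : ideal A) a n x :
  I = range ( *%R a) :> set A ->
  ideal_pow I n x <-> exists y, x = a ^+ n * y.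
Proof.
move=> Ia; elim: n x => [|n IHn] x.
  by split=> // _; exists x; rewrite expr0 mul1r.
split=> [[s Hs ->]|[y ->]].
  rewrite big_seq; elim/big_ind: _ => [|_ _ [y ->] [z ->]|u /Hs[]].
  - by exists 0; rewrite mulr0.
  - by exists (y + z); rewrite mulrDr.
  - rewrite Ia => -[b _ <-] /IHn[c ->]; exists (b * c).
    by rewrite [LHS]mulrACA -exprS.
exists [:: (a, a ^+ n * y : A^o)]; last by rewrite big_seq1 exprS -mulrA.
move=> _ /[!inE]/eqP-> /=; split; last by apply/IHn; exists y.
by rewrite Ia; exists 1; rewrite ?mulr1.
Qed.

Lemma from1_from0 (R : tower) i x : from1 R i (from0 R 1 x) = from0 R i.+1 x.
Proof.
by elim: i => // i IHi; exact: (congr1 (tower_map R i.+1) IHi).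
Qed.

(** * Multiples of [f] and torsion at each level *)

Section Preperfectoid.
Variables (p : nat) (p_prime : prime p) (R : tower) (I0 : ideal (R 0)).
Variable F : forall i, {rmorphism level_quot I0 i.+1 -> level_quot I0 i}.
Hypothesis F_preperfectoid : preperfectoid_with p F.
Variables (f : R 0) (I0_f : I0 = range ( *%R f) :> set (R 0)).
Variables (I1 : ideal (R 1)) (g : R 1).
Hypothesis I1_g : I1 = range ( *%R g) :> set (R 1).
Hypothesis I1p : ideal_pow I1 p = level_ideal I0 1 :> set (R 1).
Hypothesis kerF : forall i, [set x | F i x = 0] =
  ideal_ext (level_pi I0 i.+1 \o from1 R i : {rmorphism _ -> _}) I1.

Notation t := (tower_map R).
Notation pi := (level_pi I0).
Notation f_ i := (from0 R i f).
Notation g_ i := (from1 R i g).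
Notation tor i := (level_tor I0 (i := i)).

Let p_gt0 : (0 < p)%N := prime_gt0 p_prime.

Lemma level_idealP i x : level_ideal I0 i x <-> exists y, x = f_ i * y.
Proof. exact: mem_ideal_ext_principal. Qed.

Lemma level_pi_eqP i x y : pi i x = pi i y <-> exists z, x = y + f_ i * z.
Proof.
split=> [/ideal_piP/level_idealP[z xy]|[z ->]].
  by exists z; rewrite -xy addrC subrK.
by apply/ideal_piP/level_idealP; exists z; rewrite addrC addKr.
Qed.

Lemma level_pi_eq0P i x : pi i x = 0 <-> exists z, x = f_ i * z.
Proof.
by rewrite -(rmorph0 (pi i)); split=> [/level_pi_eqP|[z ->]];
  [|apply/level_pi_eqP; exists z]; rewrite ?add0r // => -[z ->];
  exists z; rewrite add0r.
Qed.

Lemma level_piK i (x : level_quot I0 i) : exists y, x = pi i y.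
Proof. by exists (quot_repr x); exact/esym/quot_reprK. Qed.

(** The condition [tower_tor0] collapses the varying exponents of [torsion] to exponent one. *)
Lemma level_torP i x : tor i x <-> f_ i * x = 0.
Proof.
split=> [tx|fx0 a].
  have : [set 0 : R i] (f_ i * x).
    rewrite -(tower_tor0 F_preperfectoid i).
    exists [:: (f, x : restrict (from0 R i))]; last by rewrite big_seq1.
    move=> _ /[!inE]/eqP-> /=; split=> //.
    by rewrite I0_f; exists 1; rewrite ?mulr1.
  by [].
rewrite I0_f => -[b _ <-]; exists 1%N => //.
by rewrite expr1 restrict_scaleE rmorphM mulrAC fx0 mul0r.
Qed.

Lemma level_torM i a x : tor i x -> tor i (a * x).
Proof. by move=> /level_torP fx0; apply/level_torP; rewrite mulrCA fx0 mulr0. Qed.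

Lemma mulX_tor i n x : tor i x -> f_ i ^+ n.+1 * x = 0.
Proof. by move=> /level_torP fx0; rewrite exprSr -mulrA fx0 mulr0. Qed.

Lemma level_torX i x : tor i x -> tor i (x ^+ p).
Proof. by case: p p_gt0 => // n _ tx; rewrite exprSr; apply: level_torM. Qed.

Lemma level_tor_exp i n x : f_ i ^+ n * x = 0 -> tor i x.
Proof.
move=> fnx0 a; rewrite I0_f => -[b _ <-]; exists n.+1 => //.
rewrite restrict_scaleE rmorphXn rmorphM exprMn mulrAC exprS -(mulrA _ (_ ^+ n)).
by rewrite fnx0 mulr0 mul0r.
Qed.

Lemma level_tor_expl i n x : tor i (f_ i ^+ n * x) -> tor i x.
Proof.
by move=> /level_torP; rewrite mulrA -exprS; apply: level_tor_exp.
Qed.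

(** If [f y] is torsion, then [f^2 y = 0], so [y] is torsion and is already killed by [f]. *)
Lemma level_tor_pi_eq0 i x : tor i x -> pi i x = 0 -> x = 0.
Proof.
move=> tx /level_pi_eq0P[y xE]; move: tx; rewrite xE.
by rewrite -[f_ i]expr1 => /level_tor_expl/level_torP; rewrite expr1.
Qed.

Lemma level_tor_map i x : tor i x -> tor i.+1 (t i x).
Proof.
move=> /level_torP fx0; apply/level_torP.
by rewrite [from0 R i.+1 f]/(t i (f_ i)) -rmorphM fx0 rmorph0.
Qed.

(** * Transition maps and Frobenius projections on representatives *)

Lemma tower_map_ideal i x z :
  t i x = f_ i.+1 * z -> exists y, x = f_ i * y.
Proof.
move=> txE; apply/level_pi_eq0P/(tower_bar_inj F_preperfectoid).
by rewrite rmorph0 tower_barE; apply/level_pi_eq0P; exists z.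
Qed.

Lemma frobenius_proj_map i x : F i (pi i.+1 (t i x)) = pi i (x ^+ p).
Proof.
apply: (tower_bar_inj F_preperfectoid).
by rewrite (frobenius_projE F_preperfectoid) tower_barE !rmorphXn.
Qed.

Lemma frobenius_proj_lift i y : exists x, F i (pi i.+1 x) = pi i y.
Proof.
have : [set: level_quot I0 i] (pi i y) by [].
rewrite -(frobenius_proj_surj F_preperfectoid i) => -[x _ <-].
by have [z ->] := level_piK x; exists z.
Qed.

Lemma frobenius_proj_tor i y :
  tor i y -> exists2 x, tor i.+1 x & F i (pi i.+1 x) = pi i y.
Proof.
have [Ftor [[_ _ Fsurj] FE]] := tower_tor_bij F_preperfectoid i.
by move=> /Fsurj[x tx <-]; exists x; rewrite ?FE.
Qed.

Lemma frobenius_proj_mem_tor i x :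
  tor i.+1 x -> exists2 y, tor i y & F i (pi i.+1 x) = pi i y.
Proof.
have [Ftor [[Fmap _ _] FE]] := tower_tor_bij F_preperfectoid i.
by move=> tx; exists (Ftor x); [apply: Fmap | rewrite FE].
Qed.

Lemma frobenius_proj_tor_eq0 i x :
  tor i.+1 x -> F i (pi i.+1 x) = 0 -> x = 0.
Proof.
have [Ftor [[Fmap Finj _] FE]] := tower_tor_bij F_preperfectoid i.
have t0 : tor i.+1 0 by apply/level_torP; rewrite mulr0.
(* [Ftor] is a bare bijection of sets; that it sends 0 to 0 also follows from here, because a
   torsion element vanishing modulo [f] is zero. *)
have Ftor_eq0 y : tor i.+1 y -> F i (pi i.+1 y) = 0 -> Ftor y = 0.
  by move=> ty; rewrite FE // => /level_tor_pi_eq0; apply; apply: Fmap.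
move=> tx Fx0; apply: Finj; rewrite ?inE //.
by rewrite !Ftor_eq0 // !rmorph0.
Qed.

(** [F] sends the torsion element [t x] to [x ^ p = 0], so [t x = 0]; injectivity of [tower_bar]
    then puts [x] in [(f)], which meets the torsion trivially. *)
Lemma level_tor_reduced i x : tor i x -> x ^+ p = 0 -> x = 0.
Proof.
move=> tx xp0; apply: (level_tor_pi_eq0 tx).
apply: (tower_bar_inj F_preperfectoid); rewrite rmorph0 tower_barE.
rewrite (@frobenius_proj_tor_eq0 i (t i x)) ?rmorph0 //.
  exact: level_tor_map.
by rewrite frobenius_proj_map xp0 rmorph0.
Qed.

(** * The generator [g] of [I1] *)

Lemma exists_f_gX : exists v, forall i, f_ i.+1 = g_ i ^+ p * from1 R i v.
Proof.
have : level_ideal I0 1 (f_ 1) by apply/level_idealP; exists 1; rewrite mulr1.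
rewrite -I1p => /(mem_ideal_pow_principal _ _ I1_g)[v fE]; exists v => i.
by rewrite -rmorphXn -rmorphM -fE from1_from0.
Qed.

(** Equality of the ideals [(f)] and [(g ^ p)] gives one multiplier in each direction, not a unit,
    as zero divisors may occur. Both multipliers live in [R 1] and serve all levels. *)
Lemma exists_gX_f : exists u, forall i, g_ i ^+ p = f_ i.+1 * from1 R i u.
Proof.
have : ideal_pow I1 p (g ^+ p).
  by apply/(mem_ideal_pow_principal _ _ I1_g); exists 1; rewrite mulr1.
rewrite I1p => /level_idealP[u gE]; exists u => i.
by rewrite -rmorphXn gE rmorphM from1_from0.
Qed.

Lemma level_tor_gX i n x : (n <= p)%N -> g_ i ^+ n * x = 0 -> tor i.+1 x.
Proof.
move=> le_np gx0; have [v fE] := exists_f_gX; apply/level_torP.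
by rewrite fE mulrAC -(subnK le_np) exprD -[_ * _ * x]mulrA gx0 mulr0 mul0r.
Qed.

(** Here [(g x)^p = u f x^p = 0], and the torsion contains no nonzero nilpotent. *)
Lemma mul_g_tor i x : tor i.+1 x -> g_ i * x = 0.
Proof.
move=> tx; apply: level_tor_reduced; first exact: level_torM.
have [u gE] := exists_gX_f; rewrite exprMn gE mulrAC.
by move/level_torX/level_torP: tx => ->; rewrite mul0r.
Qed.

Lemma frobenius_proj_g i : F i (pi i.+1 (g_ i)) = 0.
Proof.
suff : [set x | F i x = 0] (pi i.+1 (g_ i)) by [].
rewrite kerF.
by apply/(mem_ideal_ext_principal _ _ I1_g); exists 1; rewrite mulr1.
Qed.

Lemma frobenius_proj_eqP i x y : F i (pi i.+1 x) = F i (pi i.+1 y) ->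
  exists z, x = y + g_ i * z.
Proof.
move=> Fxy; have : [set x | F i x = 0] (pi i.+1 (x - y)).
  by rewrite /= !rmorphB /= Fxy subrr.
rewrite kerF => /(mem_ideal_ext_principal _ _ I1_g)[z' /=].
have [z ->] := level_piK z'; rewrite -rmorphM => /level_pi_eqP[w xyE].
have [v fE] := exists_f_gX.
(* Writing [f = g^p v] absorbs the error term [f w] into the multiple of [g]. *)
exists (z + g_ i ^+ p.-1 * from1 R i v * w).
rewrite mulrDr !mulrA -exprS prednK // -fE -xyE.
by rewrite addrC subrK.
Qed.

Lemma frobenius_proj_power_tor i x : tor i (x ^+ p) ->
  exists s z, tor i.+1 s /\ t i x = s + g_ i * z.
Proof.
move=> /frobenius_proj_tor[s ts Fs].
have [z txE] : exists z, t i x = s + g_ i * z.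
  by apply: frobenius_proj_eqP; rewrite Fs frobenius_proj_map.
by exists s, z.
Qed.

(** * Injectivity of [t] modulo [f] and torsion *)

Lemma tower_map_tor_ideal i x s w : tor i.+1 s -> t i x = s + f_ i.+1 * w ->
  exists s' w', tor i s' /\ x = s' + f_ i * w'.
Proof.
move=> ts txE.
have [y Fy] := frobenius_proj_lift x.
have [s2 ts2 Fs2] := frobenius_proj_tor ts.
have [z tyE] : exists z, t i.+1 y = s2 + g_ i.+1 * z.
  apply: frobenius_proj_eqP; rewrite Fs2 frobenius_proj_map rmorphXn.
  rewrite -(frobenius_projE F_preperfectoid) Fy tower_barE txE.
  by apply/level_pi_eqP; exists w.
(* As [p >= 2], the power [g^(p-1)] contains a factor [g], which kills the torsion element [s2]. *)
have p1_gt0 : (0 < p.-1)%N by rewrite -subn1 subn_gt0 prime_gt1.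
have [u gE] := exists_gX_f; have [v fE] := exists_f_gX.
have [d gyE] : exists d, g_ i ^+ p.-1 * y = f_ i.+1 * d.
  apply: (@tower_map_ideal i.+1 _ (from1 R i.+1 u * z)).
  rewrite rmorphM rmorphXn [t i.+1 (g_ i)]/(g_ i.+1) tyE mulrDr.
  rewrite -(prednK p1_gt0) {1}exprSr -mulrA (mul_g_tor ts2) mulr0 add0r.
  by rewrite (prednK p1_gt0) mulrA -exprSr prednK // gE mulrA.
(* This choice gives [g^(p-1) e = f d - g^p v d = 0], while [F e = F y] because [F] kills [g]. *)
pose e := y - g_ i * (from1 R i v * d).
have te : tor i.+1 e.
  apply: (@level_tor_gX i p.-1); first exact: leq_pred.
  by rewrite mulrBr gyE !mulrA -exprSr prednK // -fE subrr.
have [s' ts' Fe] := frobenius_proj_mem_tor te.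
exists s'; suff /level_pi_eqP[w' xE] : pi i x = pi i s' by exists w'.
rewrite -Fy -Fe /e rmorphB rmorphM rmorphB rmorphM /=.
by rewrite frobenius_proj_g mul0r subr0.
Qed.

(** * Elements whose [p]-th power is torsion *)

Lemma power_tor_step i x : tor i (x ^+ p) ->
  exists s z, [/\ tor i.+1 s, tor i.+1 (z ^+ p) & t i x = s + g_ i * z].
Proof.
move=> txp; have [s [z [ts txE]]] := frobenius_proj_power_tor txp.
exists s, z; split=> //; have [v fE] := exists_f_gX.
have gzp : tor i.+1 (g_ i ^+ p * z ^+ p).
  (* The cross terms of [(s + g z)^p] vanish because [g] kills [s]. *)
  have sgz0 : s * (g_ i * z) = 0 by rewrite mulrA [s * _]mulrC mul_g_tor ?mul0r.
  have /level_torP := level_tor_map txp.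
  rewrite rmorphXn /= txE exprD_mul0 // mulrDr.
  by move/level_torX/level_torP: ts => ->; rewrite add0r exprMn => /level_torP.
apply: (@level_tor_expl _ 1).
by rewrite expr1 fE mulrAC mulrC; apply: level_torM.
Qed.

(** One step up the tower turns [g^n x] into [g^(n+1) z], as [n > 0] leaves a factor [g] to kill
    [s]. At [n = p] divisibility by [f] is immediate, and injectivity of [tower_bar] brings it back
    down. *)
Lemma gX_power_tor i n x : (0 < n <= p)%N -> tor i.+1 (x ^+ p) ->
  exists d, g_ i ^+ n * x = f_ i.+1 * d.
Proof.
have [u gE] := exists_gX_f.
have [m] := ubnP (p - n); elim: m => // m IHm in i n x *.
move=> lt_pn /andP[n_gt0 le_np] txp.
have [->|lt_np] := eqVneq n p.
  by exists (from1 R i u * x); rewrite gE mulrA.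
have {}lt_np : (n < p)%N by rewrite ltn_neqAle lt_np.
have [s [z [ts tzp txE]]] := power_tor_step txp.
have [d gzE] : exists d, g_ i.+1 ^+ n.+1 * z = f_ i.+2 * d.
  by apply: IHm => //; rewrite subnS prednK ?subn_gt0.
apply: (@tower_map_ideal i.+1 _ d).
rewrite rmorphM rmorphXn [t i.+1 (g_ i)]/(g_ i.+1) txE mulrDr mulrA -exprSr.
by rewrite -(prednK n_gt0) {1}exprSr -mulrA mul_g_tor // mulr0 add0r
  prednK.
Qed.

Lemma power_tor_decomp i x : tor i (x ^+ p) ->
  exists s y, [/\ tor i s, tor i (y ^+ p) & x = s + f_ i * y].
Proof.
move=> txp; have [s [z [ts tzp txE]]] := power_tor_step txp.
have [d] := @gX_power_tor i 1 z p_gt0 tzp; rewrite expr1 => gzE.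
have [s' [y [ts' xE]]] : exists s' y, tor i s' /\ x = s' + f_ i * y.
  by apply: (@tower_map_tor_ideal i x s d ts); rewrite txE gzE.
(* Since [f] kills [x^p] and [s'^p], and [s' f = 0], it kills [f^p y^p]. *)
exists s', y; split=> //; apply: (@level_tor_expl _ p).
move/level_torP: txp; rewrite xE exprD_mul0 //; last first.
  by rewrite mulrA [s' * _]mulrC; move/level_torP: ts' => ->; rewrite mul0r.
rewrite mulrDr; move/level_torX/level_torP: ts' => ->.
by rewrite add0r exprMn => /level_torP.
Qed.

(** * Separatedness and the conclusion *)

Lemma level_separatedP i x : level_separated I0 i ->
  (forall n, exists y, x = f_ i ^+ n * y) -> x = 0.
Proof.
move=> sep fx; suff : [set 0 : R i] x by [].
rewrite -sep => n _; have [y ->] := fx n.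
rewrite mulrC -rmorphXn; apply/idealM/mem_ideal_ext.
by apply/(mem_ideal_pow_principal _ _ I0_f); exists 1; rewrite mulr1.
Qed.

Lemma tower_map_injective i : level_separated I0 i -> injective (t i).
Proof.
move=> sep; suff ker0 x : t i x = 0 -> x = 0.
  move=> x y txy; apply/eqP; rewrite -subr_eq0; apply/eqP/ker0.
  by rewrite rmorphB txy subrr.
(* Exponent 0 is set apart: the induction needs a positive power of [f] to kill the torsion
   summand. *)
move=> tx0; apply: (level_separatedP sep) => -[|n].
  by exists x; rewrite expr0 mul1r.
elim: n => [|n [y xE]].
  by apply: (@tower_map_ideal i x 0); rewrite tx0 mulr0.
have ty : tor i.+1 (t i y).
  apply: (@level_tor_exp _ n.+1).
  by rewrite [from0 R i.+1 f]/(t i (f_ i)) -rmorphXn -rmorphM -xE.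
have [s [w [ts yE]]] : exists s w, tor i s /\ y = s + f_ i * w.
  by apply: (@tower_map_tor_ideal i y (t i y) 0 ty); rewrite mulr0 addr0.
by exists w; rewrite xE yE mulrDr mulX_tor // add0r mulrA -exprSr.
Qed.

Lemma power_eq0 i (x : R i) : level_separated I0 i -> x ^+ p = 0 -> x = 0.
Proof.
move=> sep xp0; suff fx0 : f_ i * x = 0.
  by apply: level_tor_reduced xp0; apply/level_torP.
apply: (level_separatedP sep) => n.
(* The extra factor [f] keeps the exponent positive, so the torsion part of [y] dies at each step;
   that [y ^ p] is torsion is what allows the next decomposition. *)
suff [y _ ->] : exists2 y, tor i (y ^+ p) & f_ i * x = f_ i ^+ n.+1 * y.
  by exists (f_ i * y); rewrite exprSr mulrA.
elim: n => [|n [y typ ->]].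
  by exists x; rewrite ?expr1 // xp0; apply/level_torP; rewrite mulr0.
have [s [z [ts tzp ->]]] := power_tor_decomp typ.
by exists z => //; rewrite mulrDr mulX_tor // add0r mulrA -exprSr.
Qed.

End Preperfectoid.

Theorem corollary3p3 (p : nat) (p_prime : prime p)
    (R : tower) (I0 : ideal (R 0))
    (R_preperfectoid : preperfectoid_tower I0 p)
    (i : nat)
    (sep_i : level_separated I0 i) (sep_i1 : level_separated I0 i.+1) :
  injective (tower_map R i) /\ reduced (R i).
Proof.
have [F HF] := R_preperfectoid.
have [f I0f] := tower_principal HF.
have [I1 [[g I1g] I1p kerF]] := tower_first_ideal HF.
split; first exact: (tower_map_injective p_prime HF I0f I1g I1p kerF).
apply: (reduced_prime_exponent (prime_gt1 p_prime)) => x.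
exact: (power_eq0 p_prime HF I0f I1g I1p kerF).
Qed.
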